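(* For every graph $G$, $mp(G) \geq \chi(G)$, and the bound is sharp.
   Context: Graphs are finite and simple. $\chi(G)$ denotes the chromatic number of $G$. A path $P = v_1 v_2 \ldots v_k$ (distinct vertices, consecutive ones adjacent) in a graph $G$ is a degree monotone path of length $k$ if $\deg(v_1) \leq \deg(v_2) \leq \ldots \leq \deg(v_k)$ or $\deg(v_1) \geq \deg(v_2) \geq \ldots \geq \deg(v_k)$, where degrees are taken in $G$; thus the length of a path is its number of vertices. $mp(G)$ denotes the maximum length of a degree monotone path in $G$. *)

(* Defs.v *)
From mathcomp Require Import all_boot.

Set Implicit Arguments.
Unset Strict Implicit.
Unset Printing Implicit Defensive.

(* The graph with no vertices is allowed; both parameters below are 0 on it. *)
Record sgraph := SGraph {
  vertex :> finType;
  adj : rel vertex;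
  adj_sym : symmetric adj;
  adj_irr : irreflexive adj
}.

Definition deg (G : sgraph) (x : G) : nat := #|[set y : G | adj x y]|.

Definition proper_coloring (G : sgraph) (k : nat) (c : {ffun G -> 'I_k}) : bool :=
  [forall x : G, forall y : G, adj x y ==> (c x != c y)].

Definition colorable (G : sgraph) (k : nat) : bool :=
  [exists c : {ffun G -> 'I_k}, proper_coloring c].

Lemma colorable_ex (G : sgraph) : exists k, colorable G k.
Proof.
exists #|G|; apply/existsP; exists [ffun x => enum_rank x].
apply/forallP=> x; apply/forallP=> y; apply/implyP=> exy.
rewrite !ffunE; apply: contraTneq exy => /enum_rank_inj ->.
by rewrite adj_irr.
Qed.

Definition chi (G : sgraph) : nat := ex_minn (colorable_ex G).

Definition graph_path (G : sgraph) (p : seq G) : bool := uniq p && sorted (@adj G) p.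

Definition degree_monotone (G : sgraph) (p : seq G) : bool :=
  sorted (fun x y => deg x <= deg y) p || sorted (fun x y => deg x >= deg y) p.

Definition has_degree_monotone_path (G : sgraph) (k : nat) : bool :=
  [exists p : k.-tuple G, graph_path p && degree_monotone p].

(* The empty sequence is admitted as a path of length 0, so that the maximum
   exists also when there are no vertices. *)
Lemma degree_monotone_path_ex (G : sgraph) :
  exists k, has_degree_monotone_path G k.
Proof. by exists 0; apply/existsP; exists [tuple]. Qed.

Lemma degree_monotone_path_le (G : sgraph) (k : nat) :
  has_degree_monotone_path G k -> k <= #|G|.
Proof.
case/existsP=> p /andP[/andP[up _] _].
by rewrite -(size_tuple p) -(card_uniqP up) max_card.
Qed.

Definition mp (G : sgraph) : nat :=
  ex_maxn (degree_monotone_path_ex G) (@degree_monotone_path_le G).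

(* Main.v *)
Require Import Defs.
From mathcomp Require Import all_boot.

(** The lower bound is the Gallai-Roy argument for an orientation of [G] whose
    directed paths are all degree monotone. Order the vertices by degree, break
    ties arbitrarily, and direct each edge upwards. Along a directed path
    the vertices strictly increase, so they are distinct, and their degrees do
    not decrease; hence such a path has at most [mp G] vertices
    ([increasing_path_le_mp]). Coloring each vertex by the length of a longest
    directed path that starts there uses at most [mp G] colors, and it is
    proper because an edge from [x] to [y] prolongs every directed path that
    starts at [y] ([colorable_of_increasing_paths]).

    Complete graphs attain the bound: a proper coloring of [complete k] is
    injective, so [k <= chi <= mp], while a path has at most as many vertices
    as the graph. *)

Set Implicit Arguments.
Unset Strict Implicit.
Unset Printing Implicit Defensive.

Lemma chi_le (G : sgraph) k : colorable G k -> chi G <= k.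
Proof. by rewrite /chi; case: ex_minnP => m _; apply. Qed.

Lemma colorable_chi (G : sgraph) : colorable G (chi G).
Proof. by rewrite /chi; case: ex_minnP. Qed.

Lemma mp_ge (G : sgraph) (p : seq G) :
  graph_path p -> degree_monotone p -> size p <= mp G.
Proof.
move=> path_p mono_p; rewrite /mp; case: ex_maxnP => m _; apply.
by apply/existsP; exists (in_tuple p); rewrite path_p mono_p.
Qed.

Lemma mp_le_card (G : sgraph) : mp G <= #|G|.
Proof. by rewrite /mp; case: ex_maxnP => m /degree_monotone_path_le. Qed.

(** The acyclic orientation of [G] that directs each edge towards the larger
    value of [f]; every edge is directed when [f] is injective. *)
Definition increasing_edge (G : sgraph) (f : G -> nat) : rel G :=
  fun x y => adj x y && (f x < f y).

(** The Gallai-Roy theorem for acyclic orientations. The color of [x] is the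
    number of edges of a longest increasing path that starts at [x]. *)
Lemma colorable_of_increasing_paths (G : sgraph) (f : G -> nat) (m : nat) :
    injective f ->
    (forall x p, path (increasing_edge f) x p -> size p < m) ->
  colorable G m.
Proof.
move=> f_inj short.
pose starts x k := [exists p : k.-tuple G, path (increasing_edge f) x p].
pose height x := \max_(k < m | starts x k) k.
have m_gt0 (x : G) : 0 < m by exact: (short x [::]).
have starts_height x : starts x (height x).
  (* The trivial path makes the maximum range over a nonempty set. *)
  have start0 : 0 < #|[pred k : 'I_m | starts x k]|.
    apply/card_gt0P; exists (Ordinal (m_gt0 x)).
    by rewrite inE; apply/existsP; exists [tuple].
  rewrite /height.
  by have [k starts_k ->] := eq_bigmax_cond (@nat_of_ord m) start0.
have height_lt x : height x < m.
  by have /existsP[p /short] := starts_height x; rewrite size_tuple.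
have height_edge x y : increasing_edge f x y -> height y < height x.
  move=> exy; have /existsP[p path_p] := starts_height y.
  have path_yp : path (increasing_edge f) x (y :: p) by rewrite /= exy.
  have lt_m : (height y).+1 < m.
    by have := short _ _ path_yp; rewrite /= size_tuple.
  apply: (@leq_bigmax_cond _ (fun k : 'I_m => starts x k) (@nat_of_ord m)
            (Ordinal lt_m)).
  by apply/existsP; exists [tuple of y :: p].
apply/existsP; exists [ffun x => Ordinal (height_lt x)].
apply/forallP=> x; apply/forallP=> y; apply/implyP=> adj_xy.
rewrite !ffunE -val_eqE /=.
have [lt_f | lt_f | eq_f] := ltngtP (f x) (f y).
- by rewrite gtn_eqF // height_edge // /increasing_edge adj_xy.
- by rewrite ltn_eqF // height_edge // /increasing_edge adj_sym adj_xy.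
- by move: adj_xy; rewrite (f_inj _ _ eq_f) adj_irr.
Qed.

(** An encoding in [nat] of the lexicographic order on degree and then position
    in the enumeration of the vertices: the latter is less than [#|G|]. *)
Definition degree_rank (G : sgraph) (x : G) : nat :=
  deg x * #|G| + enum_rank x.

Lemma degree_rank_inj (G : sgraph) : injective (@degree_rank G).
Proof.
move=> x y /(congr1 (modn^~ #|G|)).
by rewrite /degree_rank !modnMDl !modn_small // => /val_inj/enum_rank_inj.
Qed.

Lemma degree_rank_lt (G : sgraph) (x y : G) :
  degree_rank x < degree_rank y -> deg x <= deg y.
Proof.
rewrite /degree_rank; apply: contraTT; rewrite -leqNgt -ltnNge => lt_deg.
apply: leq_trans (leq_addr _ _); apply: (@leq_trans ((deg y).+1 * #|G|)).
  by rewrite mulSn addnC leq_add2r ltnW.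
by rewrite leq_mul2r lt_deg orbT.
Qed.

Lemma increasing_path_le_mp (G : sgraph) (x : G) (p : seq G) :
  path (increasing_edge (@degree_rank G)) x p -> size p < mp G.
Proof.
move=> path_p; apply: (@mp_ge G (x :: p)).
- apply/andP; split.
  + apply: (@sorted_uniq _ (relpre (@degree_rank G) ltn)).
    * by move=> ? ? ?; apply: ltn_trans.
    * by move=> ?; apply: ltnn.
    * by apply: sub_path path_p => y z /andP[].
  + by apply: sub_path path_p => y z /andP[].
- apply/orP; left.
  by apply: sub_path path_p => y z /andP[_ /degree_rank_lt].
Qed.

Lemma chi_le_mp (G : sgraph) : chi G <= mp G.
Proof.
apply/chi_le/(colorable_of_increasing_paths (@degree_rank_inj G)).
exact: increasing_path_le_mp.
Qed.

Definition complete (k : nat) : sgraph :=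
  @SGraph 'I_k (fun x y => x != y)
    (fun x y => congr1 negb (eq_sym x y)) (fun x => congr1 negb (eqxx x)).

Lemma chi_complete_ge (k : nat) : k <= chi (complete k).
Proof.
have /existsP[c /forallP proper_c] := colorable_chi (complete k).
have c_inj : injective c.
  move=> x y eq_c; apply/eqP; have /forallP/(_ y) := proper_c x.
  by rewrite eq_c eqxx implybF negbK.
by have := leq_card c c_inj; rewrite !card_ord.
Qed.

Theorem theorem2p2 :
  (forall G : sgraph, chi G <= mp G) /\
  (forall k : nat, exists G : sgraph, chi G = k /\ mp G = k).
Proof.
split=> [|k]; first exact: chi_le_mp.
exists (complete k).
have chi_ge := chi_complete_ge k; have chi_mp := chi_le_mp (complete k).
have mp_le : mp (complete k) <= k.
  by have := mp_le_card (complete k); rewrite card_ord.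
split; apply/eqP; rewrite eqn_leq.
- by rewrite chi_ge (leq_trans chi_mp).
- by rewrite mp_le (leq_trans chi_ge).
Qed.
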